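(* Let $f\in C^1(\mathbb{R}^d,\mathbb{R})$ and assume: (A1) there is $L\ge0$ with $\|\nabla f(x)-\nabla f(y)\|\le L\|x-y\|$ for all $x,y\in\mathbb{R}^d$; (A2a) there are a Polish probability space $(\mathsf Z,\mathcal Z,\pi^Z)$, $\eta\ge0$ and $H:\mathbb{R}^d\times\mathsf Z\to\mathbb{R}^d$ such that for all $x$, $\int H(x,z)d\pi^Z(z)=\nabla f(x)$ and $\int\|H(x,z)-\nabla f(x)\|^2d\pi^Z(z)\le\eta$; (F3) there exist $x^\star\in\arg\min_{\mathbb{R}^d}f\neq\emptyset$, $r_1\in(0,2)$, $r_2\ge0$, $\tau>0$ such that for all $x\in\mathbb{R}^d$, $\|\nabla f(x)\|^{r_1}\|x-x^\star\|^{r_2}\ge\tau(f(x)-f(x^\star))$. Let $\alpha,\gamma\in(0,1)$, let $(Z_n)_{n\in\mathbb{N}}$ be independent random variables with law $\pi^Z$, and let $(X_n)_{n\in\mathbb{N}}$ start from $X_0\in\mathbb{R}^d$ and satisfy $X_{n+1}=X_n-\gamma(n+1)^{-\alpha}H(X_n,Z_{n+1})$ for all $n\in\mathbb{N}$. Let $r_3=(1-r_1/2)^{-1}$ and assume that there exist $\beta,\varepsilon,C_{\beta,\varepsilon}\ge0$ such that for any $n\in\mathbb{N}$, $$\mathbb{E}[\|X_n-x^\star\|^{r_2r_3}]\le C_{\beta,\varepsilon}(n+1)^\beta\{1+\log(1+n)\}^\varepsilon .$$ Then there exists $C\ge0$ such that for any $N\ge1$, $$\mathbb{E}[f(X_N)]-\min_{\mathbb{R}^d}f\le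 C\,N^{-\delta_1\wedge\delta_2}\,(1+\log(1+N))^{\varepsilon},$$ where $\delta_1=\frac{r_1}{2}\big(1-\frac{r_1}{2}\big)^{-1}(1-\alpha)-\beta$ and $\delta_2=\frac{r_1}{2}\alpha-\beta\big(1-\frac{r_1}{2}\big)$.
   Context: $a\wedge b=\min(a,b)$, and $N^{-\delta_1\wedge\delta_2}$ means $N^{-(\delta_1\wedge\delta_2)}$; $0^0=1$. All functions are assumed measurable. *)

(* Defs.v *)
From HB Require Import structures.
From mathcomp Require Export all_boot all_order all_algebra.
From mathcomp Require Export all_classical all_reals all_analysis.
Export numFieldNormedType.Exports.

Set Implicit Arguments.
Unset Strict Implicit.
Unset Printing Implicit Defensive.

Import Order.TTheory GRing.Theory Num.Theory.

Local Open Scope classical_set_scope.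
Local Open Scope ring_scope.

(* The norm `|x| of 'rV[R]_d is the sup norm; the Euclidean one is used
   throughout.  Both induce the same topology, so [open], [continuous] and
   [differentiable] need no adjustment. *)
Definition enorm (R : realType) (d : nat) (x : 'rV[R]_d) : R :=
  Num.sqrt (\sum_(j < d) x 0 j ^+ 2).

Definition grad (R : realType) (d : nat) (f : 'rV[R]_d -> R)
    (x : 'rV[R]_d) : 'rV[R]_d :=
  \row_(j < d) 'D_(delta_mx 0 j) f x.

Definition C1 (R : realType) (d : nat) (f : 'rV[R]_d -> R) : Prop :=
  (forall x, differentiable f x) /\ continuous (grad f).

(* The space T equipped with its Borel sigma-algebra. *)
Notation borel T := (g_sigma_algebraType (@open T)).

(* The metric is existentially quantified, as only the topology of a Polish
   space is part of its structure. *)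
Definition polish (R : realType) (T : topologicalType) : Prop :=
  (exists2 D : set T, countable D & dense D) /\
  exists rho : T -> T -> R,
    [/\ [/\ forall x y, 0 <= rho x y,
            forall x y, rho x y = 0 <-> x = y,
            forall x y, rho x y = rho y x &
            forall x y z, rho x z <= rho x y + rho y z],
        forall (x : T) (A : set T),
          nbhs x A <-> exists2 e, 0 < e & [set y | rho x y < e] `<=` A &
        forall u : nat -> T,
          (forall e, 0 < e -> exists N : nat, forall m n : nat,
             (N <= m)%N -> (N <= n)%N -> rho (u m) (u n) < e) ->
          exists l : T, u @ \oo --> l].

Definition mutually_independent (R : realType) (dO dT : measure_display)
    (Omega : measurableType dO) (T : measurableType dT)
    (P : probability Omega R) (I : eqType) (Y : I -> Omega -> T) : Prop :=
  forall (s : seq I) (A : I -> set T),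
    uniq s -> (forall i, measurable (A i)) ->
    P (\bigcap_(i in [set` s]) (Y i @^-1` A i)) =
    (\prod_(i <- s) P (Y i @^-1` A i))%E.

(* For a vector-valued g, "the integral of g is m": each coordinate is
   integrable, with integral the corresponding coordinate of m. *)
Definition has_mean (R : realType) (dT : measure_display)
    (T : measurableType dT) (mu : probability T R) (d : nat)
    (g : T -> 'rV[R]_d) (m : 'rV[R]_d) : Prop :=
  forall j : 'I_d,
    mu.-integrable [set: T] (fun z => (g z 0 j)%:E) /\
    (\int[mu]_z (g z 0 j)%:E = (m 0 j)%:E)%E.

(* Main.v *)
From HB Require Import structures.
Require Import Defs.
From mathcomp Require Import measurable_realfun lebesgue_stieltjes_measure.
From mathcomp Require Import ring lra.
Import Order.TTheory GRing.Theory Num.Theory.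
Local Open Scope classical_set_scope.
Local Open Scope ring_scope.
Set Implicit Arguments.
Unset Strict Implicit.
Unset Printing Implicit Defensive.

(** Write x* for the minimiser, c_n for the step size, u_n for the mean of
    f(X_n) - f(x* ), and G_n for the mean of |grad f(X_n)|^2.  The rate comes
    from two inequalities between these numbers.

    Descent.  A gradient-Lipschitz f lies below its quadratic models
    ([descent]).  Since X_n is a function of the noise up to time n, it is
    independent of Z_(n+1) ([markov_indep]), so the noise can be averaged out
    with X_n held fixed ([indep_integral], [step_fixed]); unbiasedness turns
    the linear term of the model into the squared gradient, and
      u_(n+1) <= u_n - (c_n - L c_n^2 / 2) G_n + L c_n^2 eta / 2
    ([sgd_step]).  All integrands that involve both X_n and Z_(n+1) are
    nonnegative, which is why Tonelli is enough and why finiteness of u_n and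
    G_n comes out of the same computation.

    Lower bound on the gradient.  With r = r1 / 2, Young's inequality with a
    free weight lam > 0 ([weighted_young]) applied under the mean to the
    Lojasiewicz-type inequality gives
      tau u_n <= r lam G_n + (1 - r) lam^(- r / (1 - r)) M_n,
    where M_n is the bound on the moment of order r2 r3.  Choosing lam
    separately for each n replaces the use of Hoelder's inequality, and
    keeps the recursion linear in u_n.

    Conclusion.  Let B_n = n^(-delta) (1 + log(1+n))^eps be the desired
    bound, and take lam proportional to
    n^((beta + delta) (1 - r) / r): then lam^(- r / (1 - r)) M_n is of order
    B_n, and the descent inequality becomes
      u_(n+1) + D theta_n (tau u_n - kappa B_n) <= u_n + c0 n^(-2 alpha),
      theta_n = n^(- alpha - (beta + delta) (1 - r) / r).
    The condition delta <= delta1 says exactly that theta_n >= 1/n, so the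
    contraction beats the decrease of B_n ([contraction_ge]); the condition
    delta <= delta2 says exactly that the noise n^(-2 alpha) is at most
    theta_n B_n ([noise_le_contraction_target]).  An induction then keeps u_n
    below C B_n: where u_n is a sizeable fraction of C B_n the contraction
    absorbs everything else, and where it is not, one noisy step cannot make
    it reach C B_(n+1) ([recursion_bound]).  *)

(** * Euclidean geometry and smooth functions *)

Definition dot (R : realType) (d : nat) (x y : 'rV[R]_d) : R :=
  \sum_(j < d) x 0 j * y 0 j.

Lemma enorm_ge0 (R : realType) (d : nat) (x : 'rV[R]_d) : 0 <= enorm x.
Proof. exact: sqrtr_ge0. Qed.

Lemma enorm_sqr (R : realType) (d : nat) (x : 'rV[R]_d) :
  enorm x ^+ 2 = dot x x.
Proof.
rewrite /enorm sqr_sqrtr; last by apply: sumr_ge0 => j _; exact: sqr_ge0.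
by apply: eq_bigr => j _; rewrite expr2.
Qed.

Lemma dotC (R : realType) (d : nat) (x y : 'rV[R]_d) : dot x y = dot y x.
Proof. by apply: eq_bigr => j _; rewrite mulrC. Qed.

Lemma dotDl (R : realType) (d : nat) (x y z : 'rV[R]_d) :
  dot (x + y) z = dot x z + dot y z.
Proof. by rewrite -big_split; apply: eq_bigr => j _; rewrite mxE mulrDl. Qed.

Lemma dotZl (R : realType) (d : nat) (a : R) (x y : 'rV[R]_d) :
  dot (a *: x) y = a * dot x y.
Proof. by rewrite /dot mulr_sumr; apply: eq_bigr => j _; rewrite mxE mulrA. Qed.

Lemma dotBl (R : realType) (d : nat) (x y z : 'rV[R]_d) :
  dot (x - y) z = dot x z - dot y z.
Proof. by rewrite dotDl -scaleN1r dotZl mulN1r. Qed.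

Lemma dotZr (R : realType) (d : nat) (a : R) (x y : 'rV[R]_d) :
  dot x (a *: y) = a * dot x y.
Proof. by rewrite dotC dotZl dotC. Qed.

Lemma enormZ_sqr (R : realType) (d : nat) (a : R) (x : 'rV[R]_d) :
  enorm (a *: x) ^+ 2 = a ^+ 2 * enorm x ^+ 2.
Proof. by rewrite !enorm_sqr dotZl dotZr mulrA expr2. Qed.

Lemma enormB_sqr (R : realType) (d : nat) (x y : 'rV[R]_d) :
  enorm (x - y) ^+ 2 = enorm x ^+ 2 - 2 * dot x y + enorm y ^+ 2.
Proof.
rewrite !enorm_sqr dotBl [dot x _]dotC [dot y _]dotC !dotBl (dotC y x); lra.
Qed.

(** Cauchy-Schwarz, by expanding the squared norm of | |y| x - |x| y |. *)
Lemma dot_le_enorm (R : realType) (d : nat) (x y : 'rV[R]_d) :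
  dot x y <= enorm x * enorm y.
Proof.
have [e0|e0] := eqVneq (enorm x * enorm y) 0.
  have dot0 (u v : 'rV[R]_d) : enorm u = 0 -> dot u v = 0.
    move=> u0; have : dot u u = 0 by rewrite -enorm_sqr u0 expr0n.
    move=> /eqP; rewrite /dot psumr_eq0 => [/allP uu|j _]; last first.
      by rewrite -expr2 sqr_ge0.
    apply: big1 => j _; have /eqP := uu j (mem_index_enum _).
    by move/eqP; rewrite mulf_eq0 orbb => /eqP ->; rewrite mul0r.
  rewrite e0; move/eqP: e0; rewrite mulf_eq0 => /orP[] /eqP /dot0 e.
    by rewrite e.
  by rewrite dotC e.
have e1 : 0 < enorm x * enorm y by rewrite lt_neqAle eq_sym e0 mulr_ge0 ?enorm_ge0.
have := sqr_ge0 (enorm (enorm y *: x - enorm x *: y)).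
rewrite enormB_sqr !enormZ_sqr dotZl dotZr => h.
rewrite -(ler_pM2l e1); nra.
Qed.

Lemma derive_grad (R : realType) (d : nat) (f : 'rV[R]_d -> R)
    (x h : 'rV[R]_d) : differentiable f x -> 'D_h f x = dot (grad f x) h.
Proof.
move=> df; rewrite deriveE// {1}(matrix.row_sum_delta h) linear_sum /=.
by apply: eq_bigr => j _; rewrite linearZ /= mxE deriveE// mulrC.
Qed.

Lemma is_derive_along (R : realType) (d : nat) (f : 'rV[R]_d -> R)
    (x h : 'rV[R]_d) (t : R) : differentiable f (x + t *: h) ->
  is_derive t 1 (fun s : R => f (x + s *: h)) (dot (grad f (x + t *: h)) h).
Proof.
move=> df.
have -> : dot (grad f (x + t *: h)) h = 'D_h f (x + t *: h).
  by rewrite derive_grad.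
have E : (fun s => s^-1 *: (f (x + (s *: (1:R) + t) *: h) - f (x + t *: h))) =
    (fun s => s^-1 *: (f (s *: h + (x + t *: h)) - f (x + t *: h))).
  by apply/funext => s; rewrite scalerDl /GRing.scale /= mulr1 addrCA.
split.
  have : derivable f (x + t *: h) h by exact: diff_derivable.
  by rewrite /derivable /= -E.
by rewrite /derive /= -E.
Qed.

(** Subtracting the quadratic model from f along the segment leaves a function
    of t whose derivative is nonpositive, by Cauchy-Schwarz and the Lipschitz
    bound on the gradient. *)
Lemma descent (R : realType) (d : nat) (f : 'rV[R]_d -> R) (L : R)
    (x h : 'rV[R]_d) :
  (forall y, differentiable f y) ->
  (forall y z, enorm (grad f y - grad f z) <= L * enorm (y - z)) ->
  f (x + h) <= f x + dot (grad f x) h + L / 2 * enorm h ^+ 2.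
Proof.
move=> df lip.
pose g (t : R) := f (x + t *: h) - dot (grad f x) h * t
                  - (L / 2 * enorm h ^+ 2) * t ^+ 2.
have gd (t : R) : is_derive t 1 g (dot (grad f (x + t *: h)) h
    - dot (grad f x) h - L * enorm h ^+ 2 * t).
  have fd := is_derive_along (df (x + t *: h)).
  rewrite /g; apply: is_derive_eq.
  by rewrite /GRing.scale /=; lra.
have := @ler0_derive1_nincr R g 0 1 _ _ _ 0 1 (lexx _) ler01 (lexx _).
rewrite /g scale0r scale1r addr0 expr0n expr1n !mulr0 !mulr1 !subr0 => H.
have {H} : f (x + h) - dot (grad f x) h - L / 2 * enorm h ^+ 2 <= f x.
  apply: H => [t _|t|]; first by have [] := gd t.
    rewrite in_itv /= => /andP[t0 t1]; rewrite derive1E.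
    have [_ ->] := gd t.
    rewrite -dotBl subr_le0 (le_trans (dot_le_enorm _ _))//.
    have := lip (x + t *: h) x; rewrite [x + _]addrC addrK => l.
    have e : enorm (t *: h) = t * enorm h.
      apply/eqP; rewrite -(@eqrXn2 _ 2)// ?enorm_ge0 ?mulr_ge0 ?enorm_ge0 ?(ltW t0)//.
      by rewrite enormZ_sqr exprMn.
    rewrite e in l.
    by rewrite (le_trans (ler_wpM2r (enorm_ge0 _) l))// expr2; lra.
  apply: continuous_subspaceT => t.
  apply/differentiable_continuous/derivable1_diffP; by have [] := gd t.
lra.
Qed.

(** The gradient step of length 1/L decreases f by at least
    |grad f(x)|^2 / (2 L), and f cannot drop below m.  This is what makes the
    squared gradient integrable as soon as f is. *)
Lemma enorm_grad_le (R : realType) (d : nat) (f : 'rV[R]_d -> R) (L m : R)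
    (x : 'rV[R]_d) : 0 < L ->
  (forall y, differentiable f y) ->
  (forall y z, enorm (grad f y - grad f z) <= L * enorm (y - z)) ->
  (forall y, m <= f y) ->
  enorm (grad f x) ^+ 2 <= 2 * L * (f x - m).
Proof.
move=> L0 df lip fm.
have := descent x (- L^-1 *: grad f x) df lip.
rewrite dotZr -enorm_sqr enormZ_sqr => h.
have := le_trans (fm _) h; set E := enorm _ ^+ 2.
have -> : L / 2 * ((- L^-1) ^+ 2 * E) = L^-1 * E / 2.
  by field; rewrite gt_eqF.
move=> {}h; have : L * (L^-1 * E) <= L * (2 * (f x - m)).
  by rewrite ler_pM2l//; lra.
by rewrite mulVKf ?gt_eqF//; lra.
Qed.

(** * Borel measurability of vector-valued maps *)

Lemma continuous_borel_measurable (R : realType) (T : ptopologicalType)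
    (f : T -> R) : continuous f -> measurable_fun [set: borel T] f.
Proof.
move=> /continuousP cf; apply: (measurability _ (RGenOpens.measurableE R)).
move=> _ [_ [a [b ->] <-]]; rewrite setTI.
by apply: sub_sigma_algebra; exact/cf/interval_open.
Qed.

Lemma coord_measurable (R : realType) (d : nat) (j : 'I_d) :
  measurable_fun [set: borel 'rV[R]_d] (fun x : borel 'rV[R]_d => x 0 j).
Proof. by apply: continuous_borel_measurable; exact: coord_continuous. Qed.

(** Every open set is a countable union of rational boxes, so the Borel
    sigma-algebra of a space of row vectors is generated by the coordinates. *)
Lemma measurable_borel_row (R : realType) (d : nat) (dO : measure_display)
    (Omega : measurableType dO) (g : Omega -> 'rV[R]_d) :
  (forall j, measurable_fun [set: Omega] (fun w => g w 0 j)) ->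
  measurable_fun [set: Omega] (g : Omega -> borel 'rV[R]_d).
Proof.
move=> mg.
have mE : @measurable _ (borel 'rV[R]_d) = <<s @open 'rV[R]_d >> by [].
apply: (measurability _ mE) => _ [U oU <-].
rewrite setTI.
pose box (p : 'rV[rat]_d * nat) : set 'rV[R]_d :=
  [set x | forall j, `|x 0 j - ratr (p.1 0 j)| < p.2.+1%:R^-1].
have -> : g @^-1` U =
    \bigcup_p (if `[< box p `<=` U >] then g @^-1` box p else set0).
  apply/seteqP; split=> [w Uw|w [p _]]; last first.
    by case: ifPn => // /asboolP pU /pU.
  have /nbhs_ballP[e /= e0 eU] : nbhs (g w) U by exact: open_nbhs_nbhs.
  have [k ke] : exists k : nat, k.+1%:R^-1 < e / 2.
    have := near_infty_natSinv_lt (PosNum (divr_gt0 e0 (ltr0n _ 2))).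
    by move=> [k _ /(_ k (leqnn _))] /=; exists k.
  have k0 : 0 < k.+1%:R^-1 :> R by rewrite invr_gt0.
  have rq j : {q : rat | `|g w 0 j - ratr q| < k.+1%:R^-1}.
    apply: cid.
    have [|q] := @rat_in_itvoo R (g w 0 j - k.+1%:R^-1) (g w 0 j + k.+1%:R^-1).
      by rewrite ltrBlDr -addrA ltrDl addr_gt0.
    rewrite in_itv /= => /andP[q1 q2]; exists q.
    by rewrite distrC ltr_distl q1 q2.
  exists (\row_j projT1 (rq j), k) => //.
  have bw : box (\row_j projT1 (rq j), k) (g w).
    by move=> j /=; rewrite mxE; exact: projT2 (rq j).
  rewrite asboolT//= => x bx; apply: eU; split=> // i j; rewrite ord1.
  have := bw j; have := bx j; rewrite /= mxE; set q := ratr _ => h1 h2.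
  rewrite /ball /= (_ : g w 0 j - x 0 j = (g w 0 j - q) - (x 0 j - q)); last first.
    by rewrite opprB addrA subrK.
  by rewrite (le_lt_trans (ler_normB _ _))// (splitr e) ltrD// (lt_trans _ ke).
apply: countable_bigcupT_measurable => [|p]; first exact: countableP.
case: ifP => // _.
have -> : g @^-1` box p = \bigcap_(j in [set: 'I_d])
    [set w | `|g w 0 j - ratr (p.1 0 j)| < p.2.+1%:R^-1].
  by apply/seteqP; split=> w h j => [_|]; exact: h.
apply: fin_bigcap_measurable => // j _.
rewrite -[X in measurable X]setTI.
have : measurable_fun [set: Omega] (fun w => `|g w 0 j - ratr (p.1 0 j)|).
  by apply: measurableT_comp => //; apply: measurable_funB.
by move=> /(_ measurableT _ (measurable_itv `]-oo, p.2.+1%:R^-1[)); rewrite set_itvNyo.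
Qed.

(** * Independence of the state from the future noise *)

Lemma measurable_preimage d1 d2 (T1 : measurableType d1) (T2 : measurableType d2)
    (f : T1 -> T2) (A : set T2) :
  measurable_fun [set: T1] f -> measurable A -> measurable (f @^-1` A).
Proof. by move=> mf mA; rewrite -[X in measurable X]setTI; exact: mf. Qed.

Lemma measure_prod_unique (R : realType) (d1 d2 : measure_display)
    (T1 : measurableType d1) (T2 : measurableType d2)
    (m1 m2 : {measure set (T1 * T2) -> \bar R}) :
  (m1 setT < +oo)%E ->
  (forall A B, measurable A -> measurable B -> m1 (A `*` B) = m2 (A `*` B)) ->
  forall S, measurable S -> m1 S = m2 S.
Proof.
move=> m1oo m12 S mS.
apply: (measure_unique
  [set A `*` B | A in d1.-measurable & B in d2.-measurable] (fun=> setT)) => //.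
- by rewrite measurable_prod_measurableType.
- move=> _ _ [A mA [B mB <-]] [C mC [D mD <-]].
  exists (A `&` C); first exact: measurableI.
  by exists (B `&` D); [exact: measurableI|rewrite setXI].
- by move=> _; exists setT => //; exists setT => //; rewrite setXTT.
- by rewrite bigcup_const//; exists 0%N.
- by move=> _ [A mA [B mB <-]]; exact: m12.
Qed.

(** Independence of an event E from rectangles extends to all measurable sets
    of the product: both sides are finite measures in S that agree on
    rectangles. *)
Lemma indep_pair (R : realType) (dO d1 d2 : measure_display)
    (Omega : measurableType dO) (P : probability Omega R)
    (T1 : measurableType d1) (T2 : measurableType d2)
    (Y : Omega -> T1) (W : Omega -> T2) (E : set Omega) :
  measurable_fun [set: Omega] Y -> measurable_fun [set: Omega] W ->
  measurable E ->
  (forall A B, measurable A -> measurable B ->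
     P (Y @^-1` A `&` (W @^-1` B) `&` E) = P (Y @^-1` A `&` W @^-1` B) * P E)%E ->
  forall S : set (T1 * T2), measurable S ->
  (P ((fun w => (Y w, W w)) @^-1` S `&` E) =
   P ((fun w => (Y w, W w)) @^-1` S) * P E)%E.
Proof.
move=> mY mW mE ind S mS.
have mYW := measurable_fun_pair mY mW.
pose push (m : {measure set Omega -> \bar R}) :=
  measure_function_pushforward__canonical__measure_function_Measure m mYW.
have PE0 : 0 <= fine (P E) by apply: fine_ge0.
have := @measure_prod_unique R d1 d2 T1 T2 (push (mrestr P mE))
  (mscale (NngNum PE0) (push P)).
rewrite /= /mscale /= /pushforward /mrestr fineK ?fin_num_measure// => H.
rewrite muleC; apply: H => //.
  by rewrite preimage_setT setTI (le_lt_trans (probability_le1 _ mE))// ltry.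
by move=> A B mA mB; rewrite muleC; exact: ind.
Qed.

(** The state of a recursion driven by independent noise is independent of the
    noise still to come.  The induction has to carry all finite families of
    future variables: joining Z_(n+1) to the family tested against X_n is what
    gives independence of the pair (X_n, Z_(n+1)), of which X_(n+1) is a
    function. *)
Lemma markov_indep (R : realType) (dO d1 d2 : measure_display)
    (Omega : measurableType dO) (P : probability Omega R)
    (S : measurableType d1) (T : measurableType d2)
    (Z : nat -> Omega -> T) (X : nat -> Omega -> S) (x0 : S)
    (Phi : nat -> S * T -> S) :
  (forall n, measurable_fun [set: Omega] (Z n)) ->
  mutually_independent P Z ->
  (forall n, measurable_fun [set: S * T] (Phi n)) ->
  (forall w, X 0%N w = x0) ->
  (forall n w, X n.+1 w = Phi n (X n w, Z n.+1 w)) ->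
  forall n, measurable_fun [set: Omega] (X n) /\
    forall A (s : seq nat) (B : nat -> set T), measurable A -> uniq s ->
      (forall i, i \in s -> (n < i)%N) -> (forall i, measurable (B i)) ->
      (P (X n @^-1` A `&` \bigcap_(i in [set` s]) (Z i @^-1` B i)) =
       P (X n @^-1` A) * P (\bigcap_(i in [set` s]) (Z i @^-1` B i)))%E.
Proof.
move=> mZ iZ mPhi X0 XS; elim=> [|n [mX iX]].
  have -> : X 0%N = cst x0 by apply/funext => w; exact: X0.
  split=> [|A s B mA us _ mB]; first exact: measurable_cst.
  rewrite preimage_cst; case: ifP => _; first by rewrite setTI probability_setT mul1e.
  by rewrite set0I measure0 mul0e.
have XE : X n.+1 = Phi n \o (fun w => (X n w, Z n.+1 w)).
  by apply/funext => w; exact: XS.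
have mXZ := measurable_fun_pair mX (mZ n.+1).
split=> [|A s B mA us sn mB]; first by rewrite XE; exact: measurableT_comp.
have mE : measurable (\bigcap_(i in [set` s]) (Z i @^-1` B i)).
  by apply: fin_bigcap_measurable => // i _; exact: measurable_preimage.
rewrite XE comp_preimage; apply: indep_pair => //; last first.
  by rewrite -[X in measurable X]setTI; exact: mPhi.
move=> C D mC mD.
have nns : n.+1 \notin s by apply/negP => /sn; rewrite ltnn.
(* Test sets for the family with n.+1 added. *)
pose B' i := if i == n.+1 then D else B i.
have mB' i : measurable (B' i) by rewrite /B'; case: ifP.
have capE : \bigcap_(i in [set` s]) (Z i @^-1` B' i) =
            \bigcap_(i in [set` s]) (Z i @^-1` B i).
  apply: eq_bigcapr => i /= si; rewrite /B'; case: eqP => // e.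
  by move: nns; rewrite -e si.
have cons_cap : \bigcap_(i in [set` n.+1 :: s]) (Z i @^-1` B' i) =
    Z n.+1 @^-1` D `&` \bigcap_(i in [set` s]) (Z i @^-1` B i).
  by rewrite bigcap_seq big_cons -bigcap_seq capE /B' eqxx.
have one_cap : \bigcap_(i in [set` [:: n.+1]]) (Z i @^-1` B' i) = Z n.+1 @^-1` D.
  by rewrite bigcap_seq big_seq1 /B' eqxx.
have u' : uniq (n.+1 :: s) by rewrite /= nns.
have lt' i : i \in n.+1 :: s -> (n < i)%N.
  by rewrite inE => /orP[/eqP ->//|/sn /ltnW].
rewrite -setIA -cons_cap (iX C (n.+1 :: s))//.
have := iZ _ _ u' mB'; rewrite big_cons -iZ//.
rewrite capE cons_cap => ->.
rewrite muleA; congr (_ * _)%E.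
rewrite -[in RHS]one_cap (iX C [:: n.+1])// => [|i]; last first.
  by rewrite inE => /eqP ->.
by rewrite one_cap /B' eqxx.
Qed.

(** * Averaging one stochastic gradient step *)

(** Under independence the joint law is the product law, and Tonelli lets one
    integrate over the noise first. *)
Lemma indep_integral (R : realType) (dO d1 d2 : measure_display)
    (Omega : measurableType dO) (P : probability Omega R)
    (T1 : measurableType d1) (T2 : measurableType d2) (mu : probability T2 R)
    (Y : Omega -> T1) (W : Omega -> T2) (g : T1 * T2 -> \bar R) :
  measurable_fun [set: Omega] Y -> measurable_fun [set: Omega] W ->
  (forall B, measurable B -> P (W @^-1` B) = mu B) ->
  (forall A B, measurable A -> measurable B ->
     P (Y @^-1` A `&` W @^-1` B) = P (Y @^-1` A) * P (W @^-1` B))%E ->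
  measurable_fun [set: T1 * T2] g -> (forall p, 0 <= g p)%E ->
  (\int[P]_w g (Y w, W w) = \int[P]_w \int[mu]_z g (Y w, z))%E.
Proof.
move=> mY mW lawW ind mg g0.
have mYW := measurable_fun_pair mY mW.
pose Y' : {mfun Omega >-> T1} := HB.pack Y (isMeasurableFun.Build _ _ _ _ _ mY).
pose YW : {mfun Omega >-> (T1 * T2)%type} :=
  HB.pack (fun w => (Y w, W w)) (isMeasurableFun.Build _ _ _ _ _ mYW).
have joint S : measurable S ->
    (distribution P Y' \x mu)%E S = distribution P YW S.
  apply: product_measure_unique => A B mA mB.
  by rewrite /distribution /pushforward /= -lawW// -ind.
have -> : (\int[P]_w g (Y w, W w) = \int[distribution P YW]_p g p)%E.
  by rewrite ge0_integral_distribution.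
rewrite (eq_measure_integral (distribution P Y' \x mu)%E) => [|S mS _]; last first.
  exact/esym/joint.
rewrite fubini_tonelli1// ge0_integral_distribution//.
  exact: measurable_fun_fubini_tonelli_F.
by move=> x; apply: integral_ge0 => z _.
Qed.

(** Integrability and value in one predicate, so that the mean of a linear
    combination is read off from those of its terms without separate
    integrability side conditions. *)
Definition expects (R : realType) (dT : measure_display)
    (T : measurableType dT) (mu : probability T R) (f : T -> R) (v : R) : Prop :=
  mu.-integrable [set: T] (EFin \o f) /\ \int[mu]_x f x = v.

Lemma expectsE (R : realType) (dT : measure_display)
    (T : measurableType dT) (mu : probability T R) (f : T -> R) (v : R) :
  expects mu f v -> (\int[mu]_x (f x)%:E = v%:E)%E.
Proof. by move=> [fi <-]; rewrite fineK//; exact: integrable_fin_num. Qed.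

Lemma expects_cst (R : realType) (dT : measure_display)
    (T : measurableType dT) (mu : probability T R) (c : R) :
  expects mu (fun=> c) c.
Proof.
split; first exact: finite_measure_integrable_cst.
by rewrite Rintegral_cst//= probability_setT mulr1.
Qed.

Lemma expectsD (R : realType) (dT : measure_display)
    (T : measurableType dT) (mu : probability T R) (f g : T -> R) (a b : R) :
  expects mu f a -> expects mu g b -> expects mu (fun x => f x + g x) (a + b).
Proof.
move=> [fi <-] [gi <-]; split; last by rewrite RintegralD.
exact: (integrableD _ fi gi).
Qed.

Lemma expectsZ (R : realType) (dT : measure_display)
    (T : measurableType dT) (mu : probability T R) (c : R) (f : T -> R) (a : R) :
  expects mu f a -> expects mu (fun x => c * f x) (c * a).
Proof.
move=> [fi <-]; split; last by rewrite RintegralZl.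
exact: (integrableZl _ c fi).
Qed.

Lemma expects_sum (R : realType) (dT : measure_display)
    (T : measurableType dT) (mu : probability T R) (I : Type) (s : seq I)
    (f : I -> T -> R) (a : I -> R) :
  (forall i, expects mu (f i) (a i)) ->
  expects mu (fun x => \sum_(i <- s) f i x) (\sum_(i <- s) a i).
Proof.
move=> fa; elim: s => [|i s ih].
  rewrite big_nil; under eq_fun do rewrite big_nil; exact: expects_cst.
by rewrite big_cons; under eq_fun do rewrite big_cons; exact: expectsD.
Qed.

Lemma expects_le (R : realType) (dT : measure_display)
    (T : measurableType dT) (mu : probability T R) (f g : T -> R) (a b : R) :
  expects mu f a -> expects mu g b -> (forall x, f x <= g x) -> a <= b.
Proof. by move=> [fi <-] [gi <-] fg; exact: le_Rintegral. Qed.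

Lemma expects_ge0_le (R : realType) (dT : measure_display)
    (T : measurableType dT) (mu : probability T R) (f : T -> R) (b : R) :
  measurable_fun [set: T] f -> (forall x, 0 <= f x) ->
  (\int[mu]_x (f x)%:E <= b%:E)%E -> exists2 a, expects mu f a & a <= b.
Proof.
move=> mf f0 fb.
have fi : mu.-integrable [set: T] (EFin \o f).
  apply/integrableP; split; first exact/measurable_EFinP.
  under eq_integral do rewrite /= ger0_norm//.
  by rewrite (le_lt_trans fb)// ltry.
exists (\int[mu]_x f x); first by [].
by rewrite -lee_fin fineK//; exact: integrable_fin_num.
Qed.

Lemma expects_dom (R : realType) (dT : measure_display)
    (T : measurableType dT) (mu : probability T R) (f g : T -> R) (b : R) :
  measurable_fun [set: T] f -> (forall x, 0 <= f x <= g x) ->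
  expects mu g b -> exists2 a, expects mu f a & a <= b.
Proof.
move=> mf fg gb; apply: expects_ge0_le => // [x|]; first by case/andP: (fg x).
rewrite -(expectsE gb) ge0_le_integral//.
- by move=> x _; rewrite lee_fin; case/andP: (fg x).
- exact/measurable_EFinP.
- by case: gb => /integrableP[].
- by move=> x _; rewrite lee_fin; case/andP: (fg x).
Qed.

Lemma expects_dot (R : realType) (dT : measure_display) (T : measurableType dT)
    (mu : probability T R) (d : nat) (g : T -> 'rV[R]_d) (m a : 'rV[R]_d) :
  has_mean mu g m -> expects mu (fun z => dot a (g z)) (dot a m).
Proof.
move=> gm; apply: expects_sum => j; apply: expectsZ.
by have [gi gE] := gm j; split=> //; rewrite /Rintegral gE.
Qed.

Lemma enorm_sqr_measurable (R : realType) (dO : measure_display)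
    (Omega : measurableType dO) (d : nat) (g : Omega -> 'rV[R]_d) :
  (forall j, measurable_fun [set: Omega] (fun w => g w 0 j)) ->
  measurable_fun [set: Omega] (fun w => enorm (g w) ^+ 2).
Proof.
move=> mg; under eq_fun do rewrite enorm_sqr.
by apply: measurable_sum => j; apply: measurable_funM.
Qed.

(** The quadratic model at x is rewritten in terms of h - grad f(x), so that
    the only random terms left are a linear one, whose mean is known because
    the noise is unbiased, and the variance. *)
Lemma step_fixed (R : realType) (d : nat) (f : 'rV[R]_d -> R) (L m : R)
    (dT : measure_display) (T : measurableType dT) (mu : probability T R)
    (h : T -> 'rV[R]_d) (eta c : R) (x : 'rV[R]_d) :
  0 <= L -> (forall y, differentiable f y) ->
  (forall y z, enorm (grad f y - grad f z) <= L * enorm (y - z)) ->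
  (forall y, m <= f y) ->
  has_mean mu h (grad f x) ->
  (\int[mu]_z (enorm (h z - grad f x) ^+ 2)%:E <= eta%:E)%E ->
  measurable_fun [set: T] (fun z => f (x - c *: h z)) ->
  (\int[mu]_z (f (x - c *: h z) - m)%:E <=
   (f x - m + - (c - L * c ^+ 2 / 2) * enorm (grad f x) ^+ 2
    + L * c ^+ 2 / 2 * eta)%:E)%E.
Proof.
move=> L0 df lip fm hm hv mfh.
have mh j : measurable_fun [set: T] (fun z => h z 0 j).
  by have [/integrableP[/measurable_EFinP]] := hm j.
have mhg : measurable_fun [set: T] (fun z => enorm (h z - grad f x) ^+ 2).
  apply: enorm_sqr_measurable => j; under eq_fun do rewrite !mxE.
  exact: measurable_funB.
have [v hvE veta] := expects_ge0_le mhg (fun=> sqr_ge0 _) hv.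
have up := expectsD (expectsD
  (expects_cst mu (f x - m - L * c ^+ 2 / 2 * enorm (grad f x) ^+ 2))
  (expectsZ (L * c ^+ 2 - c) (expects_dot (grad f x) hm)))
  (expectsZ (L * c ^+ 2 / 2) hvE).
have [|z|a aE ab] := expects_dom (f := fun z => f (x - c *: h z) - m) _ _ up.
- exact: measurable_funB.
- rewrite subr_ge0 fm /=.
  have := descent x (- c *: h z) df lip.
  rewrite enormZ_sqr dotZr scaleNr enormB_sqr (dotC (h z)) sqrrN => hd.
  by lra.
- rewrite (expectsE aE) lee_fin (le_trans ab)// -enorm_sqr.
  have : L * c ^+ 2 / 2 * v <= L * c ^+ 2 / 2 * eta.
    by rewrite ler_wpM2l// divr_ge0// mulr_ge0// sqr_ge0.
  by lra.
Qed.

Lemma sgd_map_measurable (R : realType) (d : nat) (dT : measure_display)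
    (T : measurableType dT) (H : 'rV[R]_d -> T -> 'rV[R]_d) (c : R) :
  measurable_fun [set: borel 'rV[R]_d * T]
    (fun p : borel 'rV[R]_d * T => H p.1 p.2 : borel 'rV[R]_d) ->
  measurable_fun [set: borel 'rV[R]_d * T]
    (fun p : borel 'rV[R]_d * T => p.1 - c *: H p.1 p.2 : borel 'rV[R]_d).
Proof.
move=> mH; apply: measurable_borel_row => j.
under eq_fun do rewrite !mxE.
apply: measurable_funB.
  exact: (measurableT_comp (coord_measurable j) measurable_fst).
by apply: measurable_funM => //; exact: (measurableT_comp (coord_measurable j) mH).
Qed.

(** The upper bound of [step_fixed] is itself integrable along Y, so that it
    can be integrated whatever the sign of c - L c^2 / 2; for large steps the
    conclusion still provides the finiteness of the next mean. *)
Lemma sgd_step (R : realType) (d : nat) (f : 'rV[R]_d -> R) (L m : R)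
    (dO dT : measure_display) (Omega : measurableType dO)
    (P : probability Omega R) (T : measurableType dT) (mu : probability T R)
    (H : 'rV[R]_d -> T -> 'rV[R]_d) (eta c u : R)
    (Y : Omega -> 'rV[R]_d) (W : Omega -> T) :
  0 < L -> C1 f ->
  (forall y z, enorm (grad f y - grad f z) <= L * enorm (y - z)) ->
  (forall y, m <= f y) ->
  measurable_fun [set: borel 'rV[R]_d * T]
    (fun p : borel 'rV[R]_d * T => H p.1 p.2 : borel 'rV[R]_d) ->
  (forall x, has_mean mu (H x) (grad f x)) ->
  (forall x, (\int[mu]_z (enorm (H x z - grad f x) ^+ 2)%:E <= eta%:E)%E) ->
  measurable_fun [set: Omega] (Y : Omega -> borel 'rV[R]_d) ->
  measurable_fun [set: Omega] W ->
  (forall B, measurable B -> P (W @^-1` B) = mu B) ->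
  (forall (A : set (borel 'rV[R]_d)) B, measurable A -> measurable B ->
     P (Y @^-1` A `&` W @^-1` B) = P (Y @^-1` A) * P (W @^-1` B))%E ->
  expects P (fun w => f (Y w) - m) u ->
  exists G u', [/\ 0 <= G, expects P (fun w => enorm (grad f (Y w)) ^+ 2) G,
    expects P (fun w => f (Y w - c *: H (Y w) (W w)) - m) u' &
    u' <= u - (c - L * c ^+ 2 / 2) * G + L * c ^+ 2 / 2 * eta].
Proof.
move=> L0 [df cg] lip fm mH hm hv mY mW lawW ind uE.
have cf : continuous f by move=> x; exact: differentiable_continuous.
have mf : measurable_fun [set: borel 'rV[R]_d] f.
  exact: continuous_borel_measurable.
have mD : measurable_fun [set: borel 'rV[R]_d] (fun x => enorm (grad f x) ^+ 2).
  apply: enorm_sqr_measurable => j.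
  apply: continuous_borel_measurable => x.
  exact: (continuous_comp (@cg x) (@coord_continuous R 1 d 0 j (grad f x))).
have mstep := sgd_map_measurable c mH.
have [w|G GE _] := expects_dom (measurableT_comp mD mY) _ (expectsZ (2 * L) uE).
  by rewrite /= sqr_ge0 /=; exact: enorm_grad_le.
have G0 : 0 <= G by apply: expects_le (expects_cst P 0) GE _ => w; exact: sqr_ge0.
pose g (p : borel 'rV[R]_d * T) := (f (p.1 - c *: H p.1 p.2) - m)%:E.
have mg : measurable_fun setT g.
  apply/measurable_EFinP; apply: measurable_funB => //.
  exact: (measurableT_comp mf mstep).
have g0 p : (0 <= g p)%E by rewrite lee_fin subr_ge0.
pose q := L * c ^+ 2 / 2.
have phiE := expectsD (expectsD uE (expectsZ (- (c - q)) GE)) (expects_cst P (q * eta)).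
have intE := indep_integral mY mW lawW ind mg g0.
have [|w||u' u'E u'le] := expects_ge0_le (mu := P)
  (f := fun w => f (Y w - c *: H (Y w) (W w)) - m) (b := u + - (c - q) * G + q * eta).
- apply: measurable_funB => //.
  by apply: (measurableT_comp mf (measurableT_comp mstep (measurable_fun_pair mY mW))).
- by rewrite subr_ge0.
- rewrite [leLHS]intE -(expectsE phiE); apply: ge0_le_integral => //.
  + by move=> w _; apply: integral_ge0.
  + exact: (measurableT_comp (measurable_fun_fubini_tonelli_F _ mg g0) mY).
  + by case: phiE => /integrableP[].
  + move=> w _; rewrite /g /=; apply: step_fixed => //; first exact: ltW.
    exact: (measurableT_comp mf (measurableT_comp mstep
      (pair1_measurable (T2 := T) (Y w : borel 'rV[R]_d)))).
exists G, u'; split=> //; apply: le_trans u'le _.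
by rewrite mulNr.
Qed.

(** * The scalar recursion *)

(** Here B is the target bound, th the contraction factor and nu the noise.
    With C large, if u_n >= (C/4) B_n then the term kap B_n is dominated and
    the drift is at least 2 C th_n B_n, which pays for the noise and for the
    step from B_n to B_(n+1); otherwise u_n plus the noise is at most
    (C/2) B_n, hence at most C B_(n+1).  The constant 16 <= D tau is what makes
    the drift large enough independently of C. *)
Lemma recursion_bound (R : realType) (u B th nu : nat -> R) (n0 : nat)
    (tau kap D c0 : R) :
  0 < tau -> 0 <= c0 -> 16 <= D * tau ->
  (forall n, (n0 <= n)%N -> 0 < B n) ->
  (forall n, (n0 <= n)%N -> B n / 2 <= B n.+1) ->
  (forall n, (n0 <= n)%N -> B n * (1 - th n) <= B n.+1) ->
  (forall n, (n0 <= n)%N -> 0 <= th n) ->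
  (forall n, (n0 <= n)%N -> nu n <= B n) ->
  (forall n, (n0 <= n)%N -> nu n <= th n * B n) ->
  (forall n, (n0 <= n)%N -> u n.+1 <= u n + c0 * nu n) ->
  (forall n, (n0 <= n)%N ->
     u n.+1 + D * th n * (tau * u n - kap * B n) <= u n + c0 * nu n) ->
  exists2 C : R, 0 <= C & forall n, (n0 <= n)%N -> u n <= C * B n.
Proof.
move=> tau0 c00 Dtau B0 Bhalf Bth th0 nuB nuthB uS uSD.
(* The three lower bounds serve the initial term, the domination of kap B_n,
   and the absorption of the noise. *)
pose C := Num.max (Num.max (u n0 / B n0) (8 * kap / tau)) (4 * c0).
have Cu : u n0 / B n0 <= C by rewrite /C !le_max lexx.
have Ck : 8 * kap / tau <= C by rewrite /C !le_max lexx orbT.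
have Cc : 4 * c0 <= C by rewrite /C !le_max lexx orbT.
have C0 : 0 <= C by lra.
exists C => // n; elim: n => [|n ih] n0n.
  by move: n0n Cu; rewrite leqn0 => /eqP n00; rewrite n00 ler_pdivrMr// B0 ?n00.
have [n0n'|] := leqP n0 n; last first.
  move=> nn0; have e : n.+1 = n0 by apply/eqP; rewrite eqn_leq nn0.
  by rewrite e; move: Cu; rewrite ler_pdivrMr// B0.
have {ih} uC := ih n0n'.
have Bn := B0 _ n0n'; have thn := th0 _ n0n'.
have thB : 0 <= th n * B n by rewrite mulr_ge0// ltW.
have Cbar : C * (B n * (1 - th n)) <= C * B n.+1 by rewrite ler_wpM2l ?Bth.
have Cbar2 : C * (B n / 2) <= C * B n.+1 by rewrite ler_wpM2l ?Bhalf.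
have [big|small] := leP (C / 4 * B n) (u n).
  have kC : kap <= tau * C / 8.
    by move: Ck; rewrite ler_pdivrMr//; lra.
  have e1 : tau * C / 8 * B n <= tau * u n - kap * B n.
    have : tau * (C / 4 * B n) <= tau * u n by rewrite ler_pM2l.
    have : kap * B n <= tau * C / 8 * B n by rewrite ler_pM2r.
    lra.
  have D0 : 0 <= D.
    by rewrite -(pmulr_lge0 _ tau0) (le_trans _ Dtau).
  have e2 : D * th n * (tau * C / 8 * B n) <= D * th n * (tau * u n - kap * B n).
    by rewrite ler_wpM2l// mulr_ge0.
  have e3 : 16 * (C * (th n * B n)) <= D * tau * (C * (th n * B n)).
    by rewrite ler_wpM2r// mulr_ge0.
  have e4 : c0 * nu n <= c0 * (th n * B n) by rewrite ler_wpM2l ?nuthB.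
  have e5 : c0 * (th n * B n) <= C / 4 * (th n * B n) by rewrite ler_wpM2r//; lra.
  have := uSD _ n0n'; nra.
have := uS _ n0n'.
have : c0 * nu n <= c0 * B n by rewrite ler_wpM2l ?nuB.
have : c0 * B n <= C / 4 * B n by rewrite ler_pM2r//; lra.
lra.
Qed.

(** Finitely many initial terms only affect the constant. *)
Lemma eventual_bound (R : realType) (u B : nat -> R) (n0 : nat) (C : R) :
  0 <= C -> (forall n, (0 < n)%N -> 0 < B n) ->
  (forall n, (n0 <= n)%N -> u n <= C * B n) ->
  exists2 C' : R, 0 <= C' & forall n, (0 < n)%N -> u n <= C' * B n.
Proof.
move=> C0 B0; elim: n0 C C0 => [|n0 ih] C C0 uC.
  by exists C => // n _; exact: uC.
case: n0 ih uC => [_ uC|n0 ih uC]; first by exists C.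
apply: (ih (Num.max C (u n0.+1 / B n0.+1))); first by rewrite le_max C0.
move=> n; rewrite leq_eqVlt => /predU1P[<-|n0n].
  by rewrite -ler_pdivrMr ?B0// le_max lexx orbT.
rewrite (le_trans (uC n n0n))// ler_pM2r ?le_max ?lexx// B0//.
by rewrite (leq_trans _ n0n).
Qed.

(** Multiplied by x + 1, this is the monotonicity of x |-> x^(1 - a). *)
Lemma powR_neg_step (R : realType) (a x : R) : 1 <= x -> a <= 1 ->
  x `^ (- a) * (x / (x + 1)) <= (x + 1) `^ (- a).
Proof.
move=> x1 a1.
have x0 : 0 < x by lra.
have y0 : 0 < x + 1 by lra.
have h : x `^ (1 - a) <= (x + 1) `^ (1 - a).
  by apply: ge0_ler_powR; rewrite ?subr_ge0 ?nnegrE//; lra.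
have E (z : R) : 0 < z -> z `^ (1 - a) = z * z `^ (- a).
  by move=> z0; rewrite powRD ?(gt_eqF z0) ?implybT// powRr1// ltW.
rewrite mulrA ler_pdivrMr// mulrC -E// (le_trans h)//.
by rewrite E// mulrC.
Qed.

(** The claimed rate, without its constant. *)
Definition target (R : realType) (de eps : R) (n : nat) : R :=
  n%:R `^ (- de) * (1 + ln (1 + n%:R)) `^ eps.

(** The order of c_n / lam_n, where c_n is the step size and lam_n the Young
    weight that balances the moment term against [target]. *)
Definition contraction (R : realType) (al r be de : R) (n : nat) : R :=
  n%:R `^ (- al - (be + de) * (1 - r) / r).

Lemma logn_ge1 (R : realType) (n : nat) : 1 <= 1 + ln (1 + n%:R : R).
Proof. by rewrite lerDl ln_ge0// lerDl. Qed.

Lemma target_gt0 (R : realType) (de eps : R) (n : nat) : (0 < n)%N ->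
  0 < target de eps n.
Proof.
move=> n0; rewrite mulr_gt0// powR_gt0 ?ltr0n//.
by rewrite (lt_le_trans ltr01)// logn_ge1.
Qed.

Lemma powR_le_target (R : realType) (de eps : R) (n : nat) : 0 <= eps ->
  n%:R `^ (- de) <= target de eps n.
Proof.
move=> eps0; rewrite ler_peMr ?powR_ge0//.
by rewrite -[leLHS](powRr0 (1 + ln (1 + n%:R))) ler_powR// logn_ge1.
Qed.

Lemma target_step (R : realType) (de eps : R) (n : nat) : 0 <= eps -> de <= 1 ->
  (0 < n)%N -> target de eps n * (n%:R / (n%:R + 1)) <= target de eps n.+1.
Proof.
move=> eps0 de1 n0; rewrite /target mulrAC.
have n1 : 1 <= n%:R :> R by rewrite ler1n.
apply: ler_pM.
- by rewrite mulr_ge0 ?powR_ge0// divr_ge0//; lra.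
- exact: powR_ge0.
- by rewrite -[n.+1%:R]natr1; exact: powR_neg_step.
- apply: ge0_ler_powR; rewrite ?nnegrE//.
  + exact: le_trans ler01 (logn_ge1 _ _).
  + exact: le_trans ler01 (logn_ge1 _ _).
  + by rewrite lerD2l ler_ln ?posrE ?lerD2l ?ler_nat// ltr_pwDl.
Qed.

Lemma target_half (R : realType) (de eps : R) (n : nat) : 0 <= eps -> de <= 1 ->
  (0 < n)%N -> target de eps n / 2 <= target de eps n.+1.
Proof.
move=> eps0 de1 n0; apply: le_trans (target_step eps0 de1 n0).
have n1 : 1 <= n%:R :> R by rewrite ler1n.
rewrite ler_pM2l ?target_gt0// ler_pdivlMr; last by lra.
by rewrite mulrDr mulr1; lra.
Qed.

(** Multiplying the hypothesis on de by (1 - r) / r shows that the exponent of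
    [contraction] is at least -1. *)
Lemma contraction_ge (R : realType) (al r be de : R) (n : nat) :
  0 < r -> r < 1 -> de <= r * (1 - r)^-1 * (1 - al) - be -> (0 < n)%N ->
  n%:R^-1 <= contraction al r be de n.
Proof.
move=> r0 r1 de1 n0; have n1 : 1 <= n%:R :> R by rewrite ler1n.
rewrite -powR_inv1; last by lra.
rewrite ler_powR//.
have : (be + de) * ((1 - r) / r) <= r / (1 - r) * (1 - al) * ((1 - r) / r).
  by rewrite ler_wpM2r ?divr_ge0//; lra.
have -> : r / (1 - r) * (1 - al) * ((1 - r) / r) = 1 - al.
  by field; apply/andP; split; lra.
by rewrite mulrA; lra.
Qed.

Lemma target_contraction (R : realType) (al r be de eps : R) (n : nat) :
  0 < r -> r < 1 -> 0 <= eps -> de <= 1 ->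
  de <= r * (1 - r)^-1 * (1 - al) - be -> (0 < n)%N ->
  target de eps n * (1 - contraction al r be de n) <= target de eps n.+1.
Proof.
move=> r0 r1 eps0 de_le1 de1 n0; apply: le_trans (target_step eps0 de_le1 n0).
have n1 : 1 <= n%:R :> R by rewrite ler1n.
rewrite ler_pM2l ?target_gt0//.
have -> : n%:R / (n%:R + 1) = 1 - (n%:R + 1)^-1 :> R by field; lra.
rewrite lerD2l lerN2 (le_trans _ (contraction_ge r0 r1 de1 n0))//.
by rewrite lef_pV2 ?posrE; lra.
Qed.

(** The exponents compare exactly when (be (1 - r) + de) / r <= al. *)
Lemma noise_le_contraction_target (R : realType) (al r be de eps : R) (n : nat) :
  0 < r -> 0 <= eps -> de <= r * al - be * (1 - r) -> (0 < n)%N ->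
  n%:R `^ (- al) ^+ 2 <= contraction al r be de n * target de eps n.
Proof.
move=> r0 eps0 de2 n0; have n1 : 1 <= n%:R :> R by rewrite ler1n.
rewrite (le_trans _ (ler_wpM2l (powR_ge0 _ _) (powR_le_target _ _ eps0)))//.
have nn : n%:R != 0 :> R by rewrite pnatr_eq0 -lt0n.
rewrite expr2 -!powRD ?nn ?implybT// ler_powR//.
have : (be * (1 - r) + de) / r <= r * al / r.
  by rewrite ler_pM2r ?invr_gt0//; lra.
have -> : r * al / r = al by field; lra.
have -> : (be + de) * (1 - r) / r = (be * (1 - r) + de) / r - de by field; lra.
lra.
Qed.

Lemma noise_le_target (R : realType) (al de eps : R) (n : nat) :
  0 <= eps -> de <= 2 * al -> (0 < n)%N ->
  n%:R `^ (- al) ^+ 2 <= target de eps n.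
Proof.
move=> eps0 de2 n0; have n1 : 1 <= n%:R :> R by rewrite ler1n.
rewrite (le_trans _ (powR_le_target _ _ eps0))//.
have nn : n%:R != 0 :> R by rewrite pnatr_eq0 -lt0n.
by rewrite expr2 -!powRD ?nn ?implybT// ler_powR//; lra.
Qed.

Lemma powR_pred_half (R : realType) (a : R) (n : nat) : 0 <= a -> (0 < n)%N ->
  2 `^ (- a) * n%:R `^ (- a) <= n.+1%:R `^ (- a).
Proof.
move=> a0 n0; have n1 : 1 <= n%:R :> R by rewrite ler1n.
rewrite -powRM//.
rewrite !powRN lef_pV2 ?posrE ?powR_gt0 ?ltr0n ?mulr_gt0 ?ltr0n//.
apply: ge0_ler_powR; rewrite ?nnegrE ?mulr_ge0//.
by rewrite -natr1; lra.
Qed.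

Lemma powR_neg_le (R : realType) (a : R) (n : nat) : 0 <= a -> (0 < n)%N ->
  n.+1%:R `^ (- a) <= n%:R `^ (- a).
Proof.
move=> a0 n0.
rewrite !powRN lef_pV2 ?posrE ?powR_gt0 ?ltr0n//.
by apply: ge0_ler_powR; rewrite ?nnegrE ?ler_nat.
Qed.

Lemma small_steps (R : realType) (L al gam : R) : 0 < L -> 0 < al ->
  0 <= gam -> gam <= 1 ->
  exists n0 : nat, forall n, (n0 <= n)%N -> L * (gam * n.+1%:R `^ (- al)) <= 1.
Proof.
move=> L0 al0 gam0 gam1; exists (Num.bound (L `^ al^-1)) => n nL.
have /ltW : L `^ al^-1 < n.+1%:R.
  rewrite (lt_le_trans (archi_boundP (powR_ge0 _ _)))// ler_nat.
  exact: leqW.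
move=> /(ge0_ler_powR (ltW al0)); rewrite !nnegrE powR_ge0 => /(_ isT (ler0n _ _)).
rewrite -powRrM mulVf ?gt_eqF// powRr1 ?(ltW L0)// => Ln.
rewrite mulrCA powRN -[leRHS]mulr1.
apply: ler_pM => //; first by rewrite mulr_ge0 ?invr_ge0 ?powR_ge0 ?ltW.
by rewrite ler_pdivrMr ?mul1r// powR_gt0.
Qed.

(** The Young weight at time n is Lam n^e.  The constant Lam is chosen so that
    the drift coefficient D satisfies D tau = 16; it has to be fixed before the
    constant C of the final bound, since kap depends on it. *)
Lemma rate_of_recursion (R : realType)
    (L eta tau al gam r be eps de Cbe : R) (u G : nat -> R) :
  0 < L -> 0 <= eta -> 0 < tau -> 0 < al -> al < 1 -> 0 < gam -> gam < 1 ->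
  0 < r -> r < 1 -> 0 <= be -> 0 <= eps -> 0 <= Cbe ->
  de <= r * (1 - r)^-1 * (1 - al) - be -> de <= r * al - be * (1 - r) ->
  (forall n, 0 <= G n) ->
  (forall n, let c := gam * n.+1%:R `^ (- al) in
     u n.+1 <= u n - (c - L * c ^+ 2 / 2) * G n + L * c ^+ 2 / 2 * eta) ->
  (forall n lam, 0 < lam -> tau * u n <= r * lam * G n +
     (1 - r) * lam `^ (- (r / (1 - r))) *
     (Cbe * n.+1%:R `^ be * (1 + ln (1 + n%:R)) `^ eps)) ->
  exists2 C : R, 0 <= C & forall n, (0 < n)%N -> u n <= C * target de eps n.
Proof.
move=> L0 eta0 tau0 al0 al1 gam0 gam1 r0 r1 be0 eps0 Cbe0 de1 de2 G0 uS uG.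
have [n0 n0c] := small_steps L0 al0 (ltW gam0) (ltW gam1).
pose g2 := gam * 2 `^ (- al) / 2.
have g20 : 0 < g2 by rewrite divr_gt0// mulr_gt0// powR_gt0.
pose Lam := g2 * tau / (16 * r).
have Lam0 : 0 < Lam by rewrite divr_gt0 ?mulr_gt0.
pose D := g2 / (r * Lam).
have D0 : 0 < D by rewrite divr_gt0// mulr_gt0.
have Dtau : 16 <= D * tau.
  rewrite (_ : D * tau = 16)// /D /Lam; field.
  by rewrite !gt_eqF.
pose s := r / (1 - r).
pose kap := (1 - r) * Lam `^ (- s) * (Cbe * 2 `^ be).
pose e := (be + de) * (1 - r) / r.
have es : e * s = be + de by rewrite /e /s; field; apply/andP; split; lra.
have h2 : 0 <= be * (1 - r) by rewrite mulr_ge0//; lra.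
have h1 : r * al <= 1 * al by rewrite ler_pM2r// ltW.
have de_le1 : de <= 1 by lra.
have de_2al : de <= 2 * al by lra.
pose nu (n : nat) : R := n%:R `^ (- al) ^+ 2.
have c_le n : (0 < n)%N -> (gam * n.+1%:R `^ (- al)) ^+ 2 <= nu n.
  move=> n1; rewrite lerXn2r ?nnegrE ?mulr_ge0 ?powR_ge0 ?(ltW gam0)//.
  rewrite -[leRHS]mul1r; apply: ler_pM; rewrite ?powR_ge0 ?(ltW gam0) ?(ltW gam1)//.
  exact: powR_neg_le (ltW al0) n1.
have descent n : (maxn 1 n0 <= n)%N ->
    u n.+1 + g2 * n%:R `^ (- al) * G n <= u n + L * eta / 2 * nu n.
  rewrite geq_max => /andP[n1 nn0]; have := uS n; have := n0c n nn0.
  have := c_le n n1; have := powR_pred_half (ltW al0) n1.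
  set c := gam * _ => clow cup cL /= uSn.
  have c0 : 0 <= c by rewrite mulr_ge0 ?powR_ge0 ?ltW.
  have e1 : L * c ^+ 2 <= c by rewrite expr2 mulrA -[leRHS]mul1r ler_wpM2r.
  have e2 : c / 2 * G n <= (c - L * c ^+ 2 / 2) * G n by rewrite ler_wpM2r//; lra.
  (* g2 contains the factor 2^(-al) lost by comparing n.+1 with n. *)
  have e3 : g2 * n%:R `^ (- al) <= c / 2.
    rewrite /g2 mulrAC ler_pM2r// -mulrA /c ler_pM2l//.
  have e4 : g2 * n%:R `^ (- al) * G n <= c / 2 * G n by rewrite ler_wpM2r.
  have e5 : L * eta / 2 * c ^+ 2 <= L * eta / 2 * nu n.
    by rewrite ler_wpM2l// divr_ge0 ?mulr_ge0// ltW.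
  have e6 : L * c ^+ 2 / 2 * eta = L * eta / 2 * c ^+ 2 by ring.
  lra.
have drift n : (0 < n)%N ->
    D * contraction al r be de n * (tau * u n - kap * target de eps n) <=
    g2 * n%:R `^ (- al) * G n.
  move=> n1; have nx : 0 < n%:R :> R by rewrite ltr0n.
  have nn : n%:R != 0 :> R by rewrite gt_eqF.
  have x0 : 0 < n%:R `^ e by rewrite powR_gt0.
  have := uG n (Lam * n%:R `^ e) (mulr_gt0 Lam0 x0); set M := _ `^ eps.
  rewrite powRM ?powR_ge0 ?(ltW Lam0)// -powRrM mulrN es => uGn.
  have kapB : (1 - r) * (Lam `^ (- s) * n%:R `^ (- (be + de))) *
      (Cbe * n.+1%:R `^ be * M) <= kap * target de eps n.
    have -> : kap * target de eps n =
        (1 - r) * (Lam `^ (- s) * n%:R `^ (- (be + de))) *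
        (Cbe * (2 `^ be * n%:R `^ be) * M).
      rewrite /kap /target -/M opprD powRD ?nn ?implybT// [n%:R `^ (- be)]powRN.
      by field; rewrite gt_eqF ?powR_gt0.
    rewrite ler_wpM2l ?mulr_ge0 ?powR_ge0//; first by lra.
    rewrite ler_wpM2r ?powR_ge0// ler_wpM2l// -powRM//.
    apply: ge0_ler_powR; rewrite ?nnegrE ?mulr_ge0//.
    have n1R : 1 <= n%:R :> R by rewrite ler1n.
    by rewrite -natr1; lra.
  have main : tau * u n - kap * target de eps n <= r * (Lam * n%:R `^ e) * G n.
    by lra.
  have cE : contraction al r be de n = n%:R `^ (- al) / n%:R `^ e.
    by rewrite /contraction -/e powRD ?nn ?implybT// [_ `^ (- e)]powRN.
  have c0 : 0 <= D * contraction al r be de n.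
    exact: (mulr_ge0 (ltW D0) (powR_ge0 _ _)).
  rewrite (le_trans (ler_wpM2l c0 main))// cE /D.
  rewrite le_eqVlt; apply/orP; left; apply/eqP; field.
  by rewrite !gt_eqF.
have pos n : (maxn 1 n0 <= n)%N -> (0 < n)%N by rewrite geq_max => /andP[].
have c00 : 0 <= L * eta / 2 by rewrite divr_ge0// mulr_ge0// ltW.
have [] := @recursion_bound R u (target de eps) (contraction al r be de) nu
  (maxn 1 n0) tau kap D (L * eta / 2) tau0 c00 Dtau.
- by move=> n /pos n1; exact: target_gt0.
- by move=> n /pos n1; exact: target_half.
- by move=> n /pos n1; exact: target_contraction.
- by move=> n _; exact: powR_ge0.
- by move=> n /pos n1; exact: noise_le_target.
- by move=> n /pos n1; exact: noise_le_contraction_target.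
- move=> n nn; have := descent n nn.
  have : 0 <= g2 * n%:R `^ (- al) * G n.
    by rewrite mulr_ge0// mulr_ge0 ?powR_ge0// ltW.
  lra.
- by move=> n nn; have := descent n nn; have := drift n (pos _ nn); lra.
- move=> C C0 uC; apply: eventual_bound C0 _ uC => n n1; exact: target_gt0.
Qed.

(** * From the gradient inequality to the rate *)

(** Young's inequality with exponents 1/r and 1/(1-r) for the factors
    (lam a^2)^r and lam^(-r) b. *)
Lemma weighted_young (R : realType) (a b r lam : R) :
  0 <= a -> 0 <= b -> 0 < r -> r < 1 -> 0 < lam ->
  a `^ (r * 2) * b <=
  r * lam * a ^+ 2 + (1 - r) * lam `^ (- (r / (1 - r))) * b `^ (1 - r)^-1.
Proof.
move=> a0 b0 r0 r1 lam0.
have q0 : 0 < 1 - r by lra.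
have la0 : 0 <= lam * a ^+ 2 by rewrite mulr_ge0 ?sqr_ge0// ltW.
have := conjugate_powR (powR_ge0 (lam * a ^+ 2) r)
  (mulr_ge0 (powR_ge0 lam (- r)) b0) (p := r^-1) (q := (1 - r)^-1).
rewrite !invrK !invr_gt0 => /(_ r0 q0); rewrite subrKC => /(_ erefl).
rewrite [X in X <= _](_ : _ = a `^ (r * 2) * b); last first.
  rewrite powRM ?sqr_ge0 ?(ltW lam0)// powRN -(powR_mulrn 2 a0) -powRrM.
  rewrite [2 * r]mulrC; field.
  by rewrite gt_eqF// powR_gt0.
rewrite -powRrM mulfV ?gt_eqF// powRr1// powRM ?powR_ge0// -powRrM mulNr.
move=> h; apply: le_trans h _; rewrite le_eqVlt; apply/orP; left; apply/eqP; ring.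
Qed.

Lemma enorm_measurable (R : realType) (dO : measure_display)
    (Omega : measurableType dO) (d : nat) (g : Omega -> 'rV[R]_d) :
  (forall j, measurable_fun [set: Omega] (fun w => g w 0 j)) ->
  measurable_fun [set: Omega] (fun w => enorm (g w)).
Proof.
move=> mg; under eq_fun do rewrite -[enorm _]ger0_norm ?enorm_ge0// -sqrtr_sqr.
have msqrt : measurable_fun [set: R] (@Num.sqrt R).
  by apply: continuous_measurable_fun; exact: sqrt_continuous.
exact: (measurableT_comp msqrt (enorm_sqr_measurable mg)).
Qed.

Theorem theorem12 (R : realType) (d : nat) (f : 'rV[R]_d -> R)
    (f_C1 : C1 f)
    (* (A1) *)
    (L : R) (L_ge0 : 0 <= L)
    (A1 : forall x y : 'rV[R]_d,
       enorm (grad f x - grad f y) <= L * enorm (x - y))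
    (* (A2a) *)
    (T : ptopologicalType) (T_polish : polish R T)
    (piZ : probability (borel T) R)
    (eta : R) (eta_ge0 : 0 <= eta)
    (H : 'rV[R]_d -> T -> 'rV[R]_d)
    (H_meas : measurable_fun [set: borel 'rV[R]_d * borel T]
       (fun p : borel 'rV[R]_d * borel T => H p.1 p.2 : borel 'rV[R]_d))
    (H_mean : forall x : 'rV[R]_d,
       has_mean piZ (H x : borel T -> 'rV[R]_d) (grad f x))
    (H_var : forall x : 'rV[R]_d,
       (\int[piZ]_z (enorm (H x z - grad f x) ^+ 2)%:E <= eta%:E)%E)
    (* (F3) *)
    (xstar : 'rV[R]_d) (xstar_argmin : forall x : 'rV[R]_d, f xstar <= f x)
    (r1 r2 tau : R) (r1_gt0 : 0 < r1) (r1_lt2 : r1 < 2)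
    (r2_ge0 : 0 <= r2) (tau_gt0 : 0 < tau)
    (F3 : forall x : 'rV[R]_d,
       tau * (f x - f xstar) <=
       enorm (grad f x) `^ r1 * enorm (x - xstar) `^ r2)
    (* stochastic gradient descent *)
    (alpha gamma : R) (alpha_gt0 : 0 < alpha) (alpha_lt1 : alpha < 1)
    (gamma_gt0 : 0 < gamma) (gamma_lt1 : gamma < 1)
    (dO : measure_display) (Omega : measurableType dO)
    (P : probability Omega R)
    (Z : nat -> {RV P >-> borel T})
    (Z_indep : mutually_independent P (fun n => Z n : Omega -> borel T))
    (Z_law : forall (n : nat) (A : set (borel T)),
       measurable A -> distribution P (Z n) A = piZ A)
    (X : nat -> Omega -> 'rV[R]_d) (x0 : 'rV[R]_d)
    (X_init : forall w : Omega, X 0%N w = x0)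
    (X_step : forall (n : nat) (w : Omega),
       X n.+1 w =
       X n w - (gamma * n.+1%:R `^ (- alpha)) *: H (X n w) (Z n.+1 w))
    (* moment bound *)
    (r3 : R) (r3_def : r3 = (1 - r1 / 2)^-1)
    (beta eps Cbe : R)
    (beta_ge0 : 0 <= beta) (eps_ge0 : 0 <= eps) (Cbe_ge0 : 0 <= Cbe)
    (X_moment : forall n : nat,
       ('E_P[fun w => (enorm (X n w - xstar) `^ (r2 * r3))%R] <=
        (Cbe * n.+1%:R `^ beta * (1 + ln (1 + n%:R)) `^ eps)%:E)%E)
    (delta1 delta2 : R)
    (delta1_def :
       delta1 = r1 / 2 * (1 - r1 / 2)^-1 * (1 - alpha) - beta)
    (delta2_def : delta2 = r1 / 2 * alpha - beta * (1 - r1 / 2)) :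
  exists2 C : R, 0 <= C &
    forall N : nat, (1 <= N)%N ->
      ('E_P[fun w => f (X N w)] - (f xstar)%:E <=
       (C * N%:R `^ (- Num.min delta1 delta2) *
        (1 + ln (1 + N%:R)) `^ eps)%:E)%E.
Proof.
(* L may be 0, and 1 / L is used as a step length. *)
have L1 : 0 < L + 1 by lra.
have lip (y z : 'rV[R]_d) : enorm (grad f y - grad f z) <= (L + 1) * enorm (y - z).
  by rewrite (le_trans (A1 y z))// ler_wpM2r ?enorm_ge0// lerDl.
pose c (n : nat) : R := gamma * n.+1%:R `^ (- alpha).
have mZ n : measurable_fun [set: Omega] (Z n : Omega -> borel T) by [].
have lawZ n (B : set (borel T)) : measurable B -> P (Z n @^-1` B) = piZ B.
  by move=> mB; rewrite -(Z_law n B mB).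
have mPhi n := sgd_map_measurable (c n) H_meas.
have indep := markov_indep (S := borel 'rV[R]_d) mZ Z_indep mPhi X_init X_step.
have mX n : measurable_fun [set: Omega] (X n : Omega -> borel 'rV[R]_d).
  by have [] := indep n.
have indXZ n (A : set (borel 'rV[R]_d)) (B : set (borel T)) :
    measurable A -> measurable B ->
    (P (X n @^-1` A `&` Z n.+1 @^-1` B) = P (X n @^-1` A) * P (Z n.+1 @^-1` B))%E.
  move=> mA mB; have [_ /(_ A [:: n.+1] (fun=> B) mA)] := indep n.
  rewrite bigcap_seq big_seq1; apply=> // i; by rewrite inE => /eqP ->.
have step n u := @sgd_step _ _ _ _ _ _ _ _ P _ piZ H eta (c n) u _ _ L1 f_C1 lip
  xstar_argmin H_meas H_mean H_var (mX n) (mZ n.+1) (lawZ n.+1) (@indXZ n).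
pose u n : R := \int[P]_w (f (X n w) - f xstar).
pose G n : R := \int[P]_w (enorm (grad f (X n w)) ^+ 2).
have uE n : expects P (fun w => f (X n w) - f xstar) (u n).
  suff [v vE] : exists v, expects P (fun w => f (X n w) - f xstar) v.
    by split=> //; case: vE.
  elim: n => [|n [v vE]].
    by exists (f x0 - f xstar); under eq_fun do rewrite X_init; exact: expects_cst.
  have [_ [v' [_ _ v'E _]]] := step n v vE.
  by exists v'; under eq_fun do rewrite X_step.
have GE n : expects P (fun w => enorm (grad f (X n w)) ^+ 2) (G n).
  by have [g [_ [_ gE _ _]]] := step n _ (uE n); split=> //; case: gE.
have G0 n : 0 <= G n.
  by apply: expects_le (expects_cst P 0) (GE n) _ => w; exact: sqr_ge0.
have uS n : u n.+1 <= u n - (c n - (L + 1) * c n ^+ 2 / 2) * G n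
                      + (L + 1) * c n ^+ 2 / 2 * eta.
  have [g [u' [_ gE u'E]]] := step n _ (uE n).
  have -> : g = G n by case: gE => _ <-.
  suff -> : u' = u n.+1 by [].
  by case: u'E => _ <-; rewrite /u; under eq_Rintegral do rewrite -X_step.
have r0 : 0 < r1 / 2 by lra.
have r_lt1 : r1 / 2 < 1 by lra.
have uG n lam : 0 < lam -> tau * u n <= r1 / 2 * lam * G n +
    (1 - r1 / 2) * lam `^ (- (r1 / 2 / (1 - r1 / 2))) *
    (Cbe * n.+1%:R `^ beta * (1 + ln (1 + n%:R)) `^ eps).
  move=> lam0.
  have [|w||M ME Mle] := expects_ge0_le (mu := P)
    (f := fun w => enorm (X n w - xstar) `^ (r2 * r3))
    (b := Cbe * n.+1%:R `^ beta * (1 + ln (1 + n%:R)) `^ eps).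
  - have mdist : measurable_fun [set: Omega] (fun w => enorm (X n w - xstar)).
      apply: enorm_measurable => j; under eq_fun do rewrite !mxE.
      apply: measurable_funB => //.
      exact: (measurableT_comp (coord_measurable j) (mX n)).
    exact: (measurableT_comp (measurable_powR (r2 * r3)) mdist).
  - exact: powR_ge0.
  - by have := X_moment n; rewrite unlock.
  have K0 : 0 <= (1 - r1 / 2) * lam `^ (- (r1 / 2 / (1 - r1 / 2))).
    by rewrite mulr_ge0 ?powR_ge0//; lra.
  apply: le_trans (lerD (lexx _) (ler_wpM2l K0 Mle)).
  apply: expects_le (expectsZ tau (uE n))
    (expectsD (expectsZ (r1 / 2 * lam) (GE n)) (expectsZ _ ME)) _ => w.
  apply: le_trans (F3 _) _.
  have := weighted_young (enorm_ge0 (grad f (X n w)))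
    (powR_ge0 (enorm (X n w - xstar)) r2) r0 r_lt1 lam0.
  by rewrite divfK// -powRrM -r3_def.
have de1 : Num.min delta1 delta2 <= r1 / 2 * (1 - r1 / 2)^-1 * (1 - alpha) - beta.
  by rewrite -delta1_def ge_min lexx.
have de2 : Num.min delta1 delta2 <= r1 / 2 * alpha - beta * (1 - r1 / 2).
  by rewrite -delta2_def ge_min lexx orbT.
have [C C0 uC] := rate_of_recursion (de := Num.min delta1 delta2) (eps := eps)
  (al := alpha) (gam := gamma) (be := beta) (Cbe := Cbe) (r := r1 / 2)
  L1 eta_ge0 tau_gt0 alpha_gt0 alpha_lt1 gamma_gt0 gamma_lt1 r0 r_lt1 beta_ge0
  eps_ge0 Cbe_ge0 de1 de2 G0 uS uG.
exists C => // N N1.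
have fE := expectsD (uE N) (expects_cst P (f xstar)).
rewrite unlock.
under eq_integral do rewrite -[f _](subrK (f xstar)).
rewrite (expectsE fE) -EFinB addrK lee_fin -mulrA.
exact: uC.
Qed.
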